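(* Fix integers $t\geq 1$ and $s\geq 3$. Then, as $m\to\infty$ (with $m\ge s$), \[ \frac{t}{(s-1)!}\, m^{s-2}+O(m^{s-3}\log m) \leq R_t(m-s,m)\leq \frac{t}{(s-2)!}\,m^{s-2}+O(m^{s-3}), \] where the constants in the $O(\cdot)$ terms may depend on $s$ and $t$.
   Context: For a $t\times n$ matrix $\mathbf{v}$ over $\mathbb{F}_q$ with rows $\overline{v}_1,\dots,\overline{v}_t$, its $t$-weight is $\mathrm{wt}^{(t)}(\mathbf{v})=\left|\bigcup_{i=1}^t \mathrm{supp}(\overline{v}_i)\right|$, and $d^{(t)}(\mathbf{u},\mathbf{v})=\mathrm{wt}^{(t)}(\mathbf{u}-\mathbf{v})$. For a linear code $C\subseteq\mathbb{F}_q^n$ and $t\in\mathbb{N}$, let $C^t$ be the set of $t\times n$ matrices all of whose rows lie in $C$. The $t$-th generalized covering radius $R_t(C)$ is the smallest integer $\rho$ such that for every $\mathbf{v}\in\mathbb{F}_q^{t\times n}$ there is $\mathbf{c}\in C^t$ with $d^{(t)}(\mathbf{v},\mathbf{c})\leq \rho$. Binary Reed–Muller codes $\mathrm{RM}(r,m)\subseteq\mathbb{F}_2^{2^m}$ ($0\le r\le m$) are defined recursively: $\mathrm{RM}(0,m)=\{\overline{0},\overline{1}\}$, $\mathrm{RM}(m,m)=\mathbb{F}_2^{2^m}$, and for $1\leq r\leq m-1$, $\mathrm{RM}(r,m)=\{(\overline{u},\overline{u}+\overline{v}) : \overline{u}\in \mathrm{RM}(r,m-1),\ \overline{v}\in\mathrm{RM}(r-1,m-1)\}$.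 It is a linear code of length $2^m$ and dimension $\sum_{i=0}^r\binom{m}{i}$. Write $R_t(r,m)=R_t(\mathrm{RM}(r,m))$. *)

(* Defs.v *)
From mathcomp Require Import all_boot all_order all_algebra.
Set Implicit Arguments. Unset Strict Implicit. Unset Printing Implicit Defensive.
Import GRing.Theory.
Local Open Scope ring_scope.

Section GenCov.
Variables (F : finFieldType) (n : nat).

Definition tweight (t : nat) (A : 'M[F]_(t, n)) : nat :=
  #|[set j : 'I_n | [exists i : 'I_t, A i j != 0]]|.

Definition tdist (t : nat) (A B : 'M[F]_(t, n)) : nat := tweight (A - B).

Definition covers (C : pred 'rV[F]_n) (t rho : nat) : bool :=
  [forall v : 'M[F]_(t, n),
     [exists c : 'M[F]_(t, n), [forall i : 'I_t, C (row i c)] && (tdist v c <= rho)%N]].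

(* R_t(C): the smallest rho such that [covers C t rho].  Since rho = n always
   works for a nonempty code, the least such rho lies in [0, n] and
   [find] over [iota 0 n.+1] returns exactly it. *)
Definition gen_cov_radius (t : nat) (C : pred 'rV[F]_n) : nat :=
  find (covers C t) (iota 0 n.+1).

End GenCov.

Fixpoint all_words (k : nat) : seq (seq 'F_2) :=
  if k is k'.+1 then [seq x :: w | x <- [:: 0; 1], w <- all_words k'] else [:: [::]].

(* The binary Reed-Muller code RM(r,m), as the explicit list of its codewords
   (sequences of length 2^m), following the recursive definition:
   RM(0,m) = {0,1}, RM(m,m) = F_2^(2^m),
   RM(r,m) = {(u, u+v) | u in RM(r,m-1), v in RM(r-1,m-1)} for 1 <= r <= m-1.
   (Values for r > m are irrelevant; we set them to the full space.) *)
Fixpoint RM_list (m r : nat) {struct m} : seq (seq 'F_2) :=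
  match m with
  | 0 => all_words 1
  | m'.+1 =>
      if r == 0%N then [:: nseq (2 ^ m'.+1) 0; nseq (2 ^ m'.+1) 1]
      else if (m'.+1 <= r)%N then all_words (2 ^ m'.+1)
      else [seq u ++ [seq p.1 + p.2 | p <- zip u v]
           | u <- RM_list m' r, v <- RM_list m' r.-1]
  end.

Definition RM (r m : nat) : pred 'rV['F_2]_(2 ^ m) :=
  fun w => [seq w ord0 j | j <- enum 'I_(2 ^ m)] \in RM_list m r.

Arguments RM : clear implicits.

Definition R_RM (t r m : nat) : nat := gen_cov_radius t (RM r m).

(* Main.v *)
(* Lower bound: RM(m-s,m) has codimension at least C(m,s-1), and a t-weight ball
   of radius rho has at most (2^m 2^t)^rho elements, so counting gives
   t C(m,s-1) <= (m+t) rho.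

   Upper bound: covering the rows separately gives R_t <= t R_1, and the
   (u | u+v) construction gives rho_s(m) <= rho_s(m-1) + rho_{s-1}(m-1), where
   rho_s(m) = R_1(m-s,m).  The leading constant is decided by s = 3, where
   rho_3(m) <= m+2: the syndrome of a word is its parity together with the symmetric
   matrix of its moments of degree at most 2, and a symmetric m x m matrix over F_2
   is a sum of at most m+1 matrices x^T x (Lempel), each of which is the matrix of
   a single point. *)
Require Import Defs.
From Stdlib Require Import Reals Factorial Lra Lia.

(* The MathComp notations stay local to this module, so that the theorem is
   parsed with the standard ones. *)
Module RMCovering.
From mathcomp Require Import all_boot all_order all_algebra zify.
Set Implicit Arguments. Unset Strict Implicit. Unset Printing Implicit Defensive.
Import GRing.Theory.
Local Open Scope ring_scope.

(** * Symmetric bilinear forms over the two-element field *)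

Section SymmetricMatrices.
Variables (F : finFieldType) (F_cases : forall x : F, x = 0 \/ x = 1).

Lemma char2_addxx (x : F) : x + x = 0.
Proof.
case: (F_cases x) => ->; first exact: addr0.
case: (F_cases (1 + 1)) => // /eqP.
by rewrite -subr_eq0 addrK oner_eq0.
Qed.

Lemma char2_mulxx (x : F) : x * x = x.
Proof. by case: (F_cases x) => ->; rewrite ?mulr0 ?mulr1. Qed.

Lemma char2_addvv (V : lmodType F) (v : V) : v + v = 0.
Proof. by rewrite -[v]scale1r -scalerDl char2_addxx scale0r. Qed.

Definition bil n (A : 'M[F]_n) (u w : 'rV[F]_n) : F := (u *m A *m w^T) 0 0.

Lemma bilDl n (A : 'M_n) u v w : bil A (u + v) w = bil A u w + bil A v w.
Proof. by rewrite /bil !mulmxDl mxE. Qed.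

Lemma bilDr n (A : 'M_n) u v w : bil A w (u + v) = bil A w u + bil A w v.
Proof. by rewrite /bil linearD mulmxDr mxE. Qed.

Lemma bilD n (A B : 'M_n) u v : bil (A + B) u v = bil A u v + bil B u v.
Proof. by rewrite /bil mulmxDr mulmxDl mxE. Qed.

Lemma bilC n (A : 'M_n) u w : A^T = A -> bil A u w = bil A w u.
Proof.
move=> sA; rewrite /bil; suff -> : w *m A *m u^T = (u *m A *m w^T)^T by rewrite [RHS]mxE.
by rewrite !trmx_mul trmxK sA mulmxA.
Qed.

Lemma bil_delta n (A : 'M_n) i j : bil A (delta_mx 0 i) (delta_mx 0 j) = A i j.
Proof. by rewrite /bil -rowE trmx_delta -colE !mxE. Qed.

Lemma bil_sqr n (x u w : 'rV_n) :
  bil (x^T *m x) u w = (u *m x^T) 0 0 * (w *m x^T) 0 0.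
Proof.
rewrite /bil mulmxA -[_ *m x *m _]mulmxA mxE big_ord1; congr (_ * _).
by rewrite -[x in LHS]trmxK -trmx_mul mxE.
Qed.

Lemma eq_bil n (A B : 'M_n) : (forall u w, bil A u w = bil B u w) -> A = B.
Proof. by move=> e; apply/matrixP=> i j; rewrite -!bil_delta e. Qed.

Lemma bil_deflate n (A : 'M_n) u v w : A^T = A ->
  bil (A + (u *m A)^T *m (u *m A)) v w = bil A v w + bil A u v * bil A u w.
Proof.
move=> sA; rewrite bilD bil_sqr trmx_mul sA /bil !mulmxA.
by rewrite -/(bil A v u) -/(bil A w u) bilC // (bilC w).
Qed.

(** The row space can only shrink, and the update puts [u^T] in the kernel. Equal ranks would make
    [A] a left multiple of the new matrix, so [A] would kill [u^T] too, against [bil A u u = 1]. *)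
Lemma rank_deflate n (A : 'M_n) u : A^T = A -> bil A u u = 1 ->
  (\rank (A + (u *m A)^T *m (u *m A))%R < \rank A)%N.
Proof.
move=> sA qu; set A' := (X in \rank X).
have le : (A' <= A)%MS.
  have -> : A' = (1%:M + (u *m A)^T *m u) *m A.
    by rewrite mulmxDl mul1mx -mulmxA.
  exact: submxMl.
rewrite ltn_neqAle mxrankS // andbT; apply/negP => /eqP e.
have /submxP [D eD] : (A <= A')%MS by rewrite -(mxrank_leqif_sup le) e.
have A'u : A' *m u^T = 0.
  rewrite /A' mulmxDl -mulmxA [u *m A *m u^T]mx11_scalar.
  by rewrite -/(bil A u u) qu mulmx1 trmx_mul sA char2_addvv.
have : bil A u u = 0 by rewrite /bil -mulmxA eD -mulmxA A'u !mulmx0 mxE.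
by move/eqP; rewrite qu oner_eq0.
Qed.

(* Deflation lowers the rank; it also leaves the form nonalternating for a suitable
   choice of [u], unless [bil A u w = bil A w w] whenever [bil A u u = 1], in which
   case [A] is already a single square. *)
Lemma nonalternating_sum_sqr n k (A : 'M[F]_n) u0 : A^T = A ->
  (\rank A <= k)%N -> bil A u0 u0 = 1 ->
  exists2 xs : seq 'rV_n, (size xs <= k)%N & A = \sum_(x <- xs) x^T *m x.
Proof.
elim: k A u0 => [|k IH] A u0 sA rA q0.
  move: rA; rewrite leqn0 mxrank_eq0 => /eqP A0.
  by move/eqP: q0; rewrite A0 /bil mulmx0 mul0mx mxE eq_sym oner_eq0.
have [/existsP[u /andP[/eqP qu /existsP[w qw]]]|/existsPn good] :=
  boolP [exists u, (bil A u u == 1) && [exists w, bil A w w != bil A u w]].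
  set A' := A + (u *m A)^T *m (u *m A).
  have [||//|xs sz eA'] := IH A' w.
  - by rewrite /A' linearD /= sA trmx_mul trmxK.
  - by rewrite -ltnS (leq_trans (rank_deflate sA qu)).
  (* The deflated form takes the value [bil A w w + bil A u w] at [w], which is 1 by the choice of
     [w]; so [w] serves as the next starting vector. *)
  - rewrite bil_deflate // char2_mulxx; move: qw.
    by case: (F_cases (bil A w w)) => ->; case: (F_cases (bil A u w)) => ->;
    rewrite ?eqxx ?add0r ?addr0.
  exists ((u *m A) :: xs) => //; rewrite big_cons -eA' /A' addrC -addrA.
  by rewrite char2_addvv addr0.
have qE u w : bil A u u = 1 -> bil A w w = bil A u w.
  move=> qu; move: (good u); rewrite qu eqxx /= => /existsPn/(_ w).
  by rewrite negbK => /eqP.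
exists [:: u0 *m A] => //; rewrite big_seq1; apply: eq_bil => w z.
rewrite bil_sqr trmx_mul sA !mulmxA -/(bil A w u0) -/(bil A z u0).
rewrite !(bilC _ u0) // -(qE u0 w) // -(qE u0 z) //.
(* If [bil A w w = 1], then [qE] applies to [w] itself. Otherwise it applies to [u0 + w], and
   comparison with [u0] gives [bil A w z = 0]. *)
case: (F_cases (bil A w w)) => qw; rewrite qw; last by rewrite mul1r -(qE w z).
have : bil A (u0 + w) (u0 + w) = 1.
  by rewrite bilDl !bilDr (bilC w u0) // -(qE u0 w) // q0 qw !addr0.
move/(qE _ z); rewrite bilDl -(qE u0 z) // => /eqP.
by rewrite mul0r -subr_eq0 opprD addrA subrr sub0r oppr_eq0 => /eqP.
Qed.

Lemma symmetric_sum_sqr n (A : 'M[F]_n) : A^T = A ->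
  exists2 xs : seq 'rV_n, (size xs <= n.+1)%N & A = \sum_(x <- xs) x^T *m x.
Proof.
move=> sA.
have [/existsP[u qu]|/existsPn alt] := boolP [exists u, bil A u u != 0].
  case: (F_cases (bil A u u)) => [/eqP|{}qu]; first by rewrite (negPf qu).
  have [xs sz ->] := nonalternating_sum_sqr sA (rank_leq_row A) qu.
  by exists xs => //; apply: leqW.
case: n A sA alt => [|n] A sA alt.
  by exists [::] => //; apply/matrixP => -[].
(* An alternating form has no vector to start from; adding the square of one basis vector supplies
   it and costs the extra summand. *)
pose e : 'rV[F]_n.+1 := delta_mx 0 0.
have [|||xs sz eA] := @nonalternating_sum_sqr _ n.+1 (A + e^T *m e) e.
- by rewrite linearD /= sA trmx_mul trmxK.
- exact: rank_leq_row.
- have /negPn/eqP := alt e; rewrite bilD => ->; rewrite add0r bil_sqr.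
  by rewrite /e trmx_delta mul_delta_mx mxE eqxx mulr1.
by exists (e :: xs) => //; rewrite big_cons -eA addrC -addrA char2_addvv addr0.
Qed.

End SymmetricMatrices.

(** * Binary words and their moments *)

Lemma F2_cases (x : 'F_2) : x = 0 \/ x = 1.
Proof. by case: x => [[|[|]]] // i; [left|right]; apply: val_inj. Qed.

Lemma all_wordsS k :
  all_words k.+1 = map (cons 0) (all_words k) ++ map (cons 1) (all_words k).
Proof. by rewrite /= cats0. Qed.

Lemma size_all_words k : size (all_words k) = (2 ^ k)%N.
Proof.
by elim: k => // k IH; rewrite all_wordsS size_cat !size_map IH expnS mul2n addnn.
Qed.

Lemma mem_all_words k w : (w \in all_words k) = (size w == k).
Proof.
elim: k w => [|k IH] w; first by rewrite inE -size_eq0.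
rewrite all_wordsS mem_cat; apply/orP/idP.
  by case=> /mapP[v]; rewrite IH => /eqP sv -> /=; rewrite sv.
case: w => // a w; rewrite eqSS -IH => wk.
by case: (F2_cases a) => ->; [left|right]; apply: map_f.
Qed.

Lemma all_words_uniq k : uniq (all_words k).
Proof.
elim: k => // k IH; rewrite all_wordsS cat_uniq !map_inj_uniq ?IH //=; last first.
- by move=> x y [].
- by move=> x y [].
rewrite andbT; apply/hasPn => x /mapP[y _ ->]; apply/mapP => -[z _ []] /eqP.
by rewrite oner_eq0.
Qed.

Lemma sum_all_wordsS (V : nmodType) k (G : seq 'F_2 -> V) :
  \sum_(x <- all_words k.+1) G x =
  \sum_(x <- all_words k) G (0 :: x) + \sum_(x <- all_words k) G (1 :: x).
Proof. by rewrite all_wordsS big_cat !big_map. Qed.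

(** Indices may repeat: since [a * a = a] in ['F_2], a list of length [k] still gives a function of
    degree at most [k]. *)
Definition monomial (s : seq nat) (x : seq 'F_2) : 'F_2 := \prod_(i <- s) x`_i.

Lemma monomial_shift s a x : monomial (map S s) (a :: x) = monomial s x.
Proof. by rewrite /monomial big_map. Qed.

Lemma monomial_head s a x : monomial (0%N :: map S s) (a :: x) = a * monomial s x.
Proof. by rewrite /monomial big_cons big_map. Qed.

Definition pairing m (f : seq 'F_2 -> 'F_2) (s : seq nat) : 'F_2 :=
  \sum_(x <- all_words m) f x * monomial s x.

Lemma pairingD m f g s :
  pairing m (fun x => f x + g x) s = pairing m f s + pairing m g s.
Proof. by rewrite -big_split; apply: eq_bigr => x _; rewrite mulrDl. Qed.

Lemma pairing_shift m f s :
  pairing m.+1 f (map S s) = pairing m (f \o cons 0) s + pairing m (f \o cons 1) s.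
Proof.
rewrite /pairing sum_all_wordsS; congr (_ + _);
by apply: eq_bigr => x _; rewrite monomial_shift.
Qed.

Lemma pairing_head m f s :
  pairing m.+1 f (0%N :: map S s) = pairing m (f \o cons 1) s.
Proof.
rewrite /pairing sum_all_wordsS big1 => [|x _].
  by rewrite add0r; apply: eq_bigr => x _; rewrite monomial_head mul1r.
by rewrite monomial_head mul0r mulr0.
Qed.

(** Orthogonality to every monomial of degree below [d], that is, membership in the dual of
    RM(d-1,m). *)
Definition orth m d f : Prop :=
  forall s, all (gtn m) s -> (size s < d)%N -> pairing m f s = 0.

(** Multiplying by the first coordinate isolates the half where it is 1, at the price of one
    degree. *)
Lemma orth_right m d f : orth m.+1 d.+1 f -> orth m d (f \o cons 1).
Proof.
move=> o s sm sd; rewrite -pairing_head; apply: o; last by rewrite /= size_map.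
by rewrite /= all_map.
Qed.

(** A monomial free of the first coordinate sees both halves alike, so no degree is lost. *)
Lemma orth_sum m d f :
  orth m.+1 d f -> orth m d (fun x => f (0 :: x) + f (1 :: x)).
Proof.
move=> o s sm sd; rewrite pairingD -pairing_shift; apply: o; last by rewrite size_map.
by rewrite all_map.
Qed.

Lemma orth_left m d f : orth m.+1 d.+1 f -> orth m d (f \o cons 0).
Proof.
move=> o s sm sd; have := orth_sum o sm (leqW sd).
by rewrite pairingD (orth_right o sm sd) addr0.
Qed.

Lemma orth_zero m f : orth m m.+1 f -> {in all_words m, forall x, f x = 0}.
Proof.
elim: m f => [|m IH] f o x.
  rewrite inE => /eqP ->; have := o [::] isT isT.
  by rewrite /pairing big_seq1 /monomial big_nil mulr1.
rewrite all_wordsS mem_cat => /orP[] /mapP[y my ->].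
  exact: (IH _ (orth_left o)).
exact: (IH _ (orth_right o)).
Qed.

Lemma F2_addr_eq0 (x y : 'F_2) : x + y = 0 -> x = y.
Proof. by case: (F2_cases x) => ->; case: (F2_cases y) => ->. Qed.

Lemma orth_const m f : orth m m f ->
  exists c, {in all_words m, forall x, f x = c}.
Proof.
elim: m f => [|m IH] f o; first by exists (f [::]) => x; rewrite inE => /eqP ->.
have [c fc] := IH _ (orth_left o); exists c => x.
rewrite all_wordsS mem_cat => /orP[] /mapP[y my ->]; first exact: fc.
by rewrite -(fc y my); apply/esym/F2_addr_eq0/(orth_zero (orth_sum o)).
Qed.

(** * The (u | u+v) construction and duality *)

Definition uuv (u v : seq 'F_2) := u ++ [seq p.1 + p.2 | p <- zip u v].

Lemma RM_listS m r : (0 < r <= m)%N ->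
  RM_list m.+1 r = [seq uuv u v | u <- RM_list m r, v <- RM_list m r.-1].
Proof. by case: r => //= r rm; rewrite ltnNge rm. Qed.

Lemma RM_list_full m r : (m <= r)%N -> RM_list m r = all_words (2 ^ m).
Proof.
by case: m => [|m] //= mr; rewrite mr; case: r mr.
Qed.

Lemma uuv_halves m (u v g : seq 'F_2 -> 'F_2) :
  (forall x, g (0 :: x) = u x) -> (forall x, g (1 :: x) = u x + v x) ->
  map g (all_words m.+1) = uuv (map u (all_words m)) (map v (all_words m)).
Proof.
move=> g0 g1; rewrite all_wordsS map_cat /uuv zip_map -!map_comp.
by congr (_ ++ _); apply: eq_map.
Qed.

Lemma map_RM_listS m r u v g : (0 < r <= m)%N ->
  (forall x, g (0 :: x) = u x) -> (forall x, g (1 :: x) = u x + v x) ->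
  map u (all_words m) \in RM_list m r -> map v (all_words m) \in RM_list m r.-1 ->
  map g (all_words m.+1) \in RM_list m.+1 r.
Proof.
by move=> rm g0 g1 uR vR; rewrite RM_listS // (uuv_halves _ g0 g1) allpairs_f.
Qed.

(** One inclusion of Reed-Muller duality: the dual of RM(m-r-1,m) lies in RM(r,m). In the recursion
    [u] is the left half and [v] the sum of the halves; [orth_left] loses one degree and [orth_sum]
    none, matching the orders [r] and [r.-1]. *)
Lemma orth_RM m r f : orth m (m - r) f -> map f (all_words m) \in RM_list m r.
Proof.
elim: m r f => [|m IH] r f o; first by rewrite RM_list_full ?mem_all_words.
have [mr|rm] := leqP m.+1 r.
  by rewrite RM_list_full // mem_all_words size_map size_all_words.
case: r rm o => [|r] rm o.
  have [c fc] := orth_const o.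
  have /all_pred1P : all (pred1 c) (map f (all_words m.+1)).
    by rewrite all_map; apply/allP => x /fc /= ->.
  rewrite size_map size_all_words => ->.
  by rewrite /= !inE; case: (F2_cases c) => ->; rewrite eqxx ?orbT.
apply: (@map_RM_listS _ _ (f \o cons 0) (fun x => f (0 :: x) + f (1 :: x))) => //.
- by move=> x; rewrite addrA (char2_addxx F2_cases) add0r.
- by apply: IH; apply: orth_left; rewrite -subSn.
by apply: IH; apply: orth_sum.
Qed.

(** * Covering a single word *)

Definition word_covers m r rho : Prop := forall f : seq 'F_2 -> 'F_2,
  exists2 g, map g (all_words m) \in RM_list m r &
    (count (fun x => f x != g x) (all_words m) <= rho)%N.

Lemma word_coversW m r a b :
  (a <= b)%N -> word_covers m r a -> word_covers m r b.
Proof. by move=> ab c f; have [g gR le] := c f; exists g => //; apply: leq_trans ab. Qed.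

Lemma word_coversS m r a b : (0 < r <= m)%N ->
  word_covers m r a -> word_covers m r.-1 b -> word_covers m.+1 r (a + b).
Proof.
move=> rm ca cb f; have [u uR ule] := ca (f \o cons 0).
have [v vR vle] := cb (fun x => f (1 :: x) + u x).
(* This is (u | u+v) as a function of the point: [u] approximates the left half, [v] the right half
   plus [u], and the two error counts add. *)
pose g x := u (behead x) + head 0 x * v (behead x).
exists g.
  by apply: map_RM_listS rm _ _ uR vR => x; rewrite /g /= ?mul0r ?addr0 ?mul1r.
rewrite all_wordsS count_cat !count_map leq_add //.
  by apply: leq_trans ule; apply: sub_count => x /=; rewrite /g /= mul0r addr0.
apply: leq_trans vle; apply: sub_count => x /=; rewrite /g /= mul1r.
by case: (F2_cases (f (1 :: x))) => ->; case: (F2_cases (u x)) => ->;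
   case: (F2_cases (v x)) => ->.
Qed.

Lemma word_covers0 m : word_covers m 0 (2 ^ m).
Proof.
move=> f; exists (fun=> 0); last by rewrite -size_all_words count_size.
by apply: orth_RM => s _ _; rewrite /pairing big1 // => x _; rewrite mul0r.
Qed.

Lemma pairing_delta m p s : size p = m ->
  pairing m (fun x => (x == p)%:R) s = monomial s p.
Proof.
move=> sp; have mp : p \in all_words m by rewrite mem_all_words sp.
rewrite /pairing (big_rem p) //= eqxx mul1r big1_seq ?addr0 // => x /=.
by rewrite mem_rem_uniq ?all_words_uniq // inE => /andP[/negPf -> _]; rewrite mul0r.
Qed.

(* Flipping [f] at the points [ps] cancels its moments of degree below [m - r]. *)
Lemma moments_near m r f (ps : seq (seq 'F_2)) :
  all (fun p => size p == m) ps ->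
  (forall s, all (gtn m) s -> (size s < m - r)%N ->
     \sum_(p <- ps) monomial s p = pairing m f s) ->
  exists2 g, map g (all_words m) \in RM_list m r &
    (count (fun x => f x != g x) (all_words m) <= size ps)%N.
Proof.
move=> szp mom; pose e x : 'F_2 := \sum_(p <- ps) (x == p)%:R.
have eE s : pairing m e s = \sum_(p <- ps) monomial s p.
  under eq_big_seq => p pps do rewrite -(pairing_delta s (eqP (allP szp p pps))).
  rewrite /pairing exchange_big /=; apply: eq_bigr => x _.
  by rewrite /e mulr_suml.
exists (fun x => f x + e x).
  apply: orth_RM => s sm sd.
  by rewrite pairingD eE mom // (char2_addxx F2_cases).
rewrite -size_filter; apply: uniq_leq_size; first exact/filter_uniq/all_words_uniq.
move=> x; rewrite mem_filter => /andP[+ _]; apply: contraR => xps.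
rewrite /e big1_seq ?addr0 // => p /= pps; case: eqP => // xp.
by rewrite xp pps in xps.
Qed.

Lemma word_covers_quadratic m : word_covers m (m - 3) m.+2.
Proof.
move=> f; pose A := \matrix_(i < m, j < m) pairing m f [:: val i; val j].
have [|xs sz eA] := symmetric_sum_sqr F2_cases (A := A).
  by apply/matrixP=> i j; rewrite !mxE; apply: eq_bigr => x _;
     congr (_ * _); rewrite /monomial !big_cons mulrCA.
pose point (v : 'rV['F_2]_m) := [seq v 0 j | j <- enum 'I_m].
have pE v (i : 'I_m) : (point v)`_i = v 0 i.
  by rewrite (nth_map i) ?size_enum_ord // nth_ord_enum.
have mom2 (i j : 'I_m) :
    \sum_(p <- map point xs) monomial [:: val i; val j] p = pairing m f [:: val i; val j].
  have := congr1 (fun B : 'M_m => B i j) eA; rewrite mxE => ->.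
  rewrite summxE big_map; apply: eq_bigr => v _.
  by rewrite /monomial !big_cons big_nil mulr1 /= !pE mxE big_ord1 mxE.
(* At most one copy of the origin: every monomial of positive degree vanishes there, so it corrects
   the parity and nothing else. It turns the bound [m.+1] into [m.+2]. *)
pose zs := nseq (pairing m f [::] != (size xs)%:R) (nseq m (0 : 'F_2)).
have zs0 i s : \sum_(p <- zs) monomial (i :: s) p = 0.
  rewrite big1_seq // => p /= /nseqP[-> _].
  by rewrite /monomial big_cons nth_nseq if_same mul0r.
have sum1 (ps : seq (seq 'F_2)) : \sum_(p <- ps) monomial [::] p = (size ps)%:R.
  by rewrite -sum1_size natr_sum; apply: eq_bigr => p _; rewrite /monomial big_nil.
have [||g gR le] := @moments_near m (m - 3) f (zs ++ map point xs).
- rewrite all_cat all_nseq size_nseq eqxx orbT /=; apply/allP => _ /mapP[v _ ->].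
  by rewrite size_map size_enum_ord.
- move=> s sm sd; have {sd} : (size s < 3)%N by apply: leq_trans sd _; rewrite leq_subCl.
  rewrite big_cat; case: s sm => [_ _|i s /= /andP[im sm] sd].
    rewrite !sum1 size_map /zs size_nseq.
    case: (F2_cases (pairing m f [::])) => ->.
      by case: (F2_cases (size xs)%:R) => ->; apply: val_inj.
    by case: (F2_cases (size xs)%:R) => ->; apply: val_inj.
  rewrite /= zs0 add0r; case: s sm sd => [_ _|j [|//] /= /andP[jm _] _].
    have := mom2 (Ordinal im) (Ordinal im); rewrite /=.
    (* Moments of degree 1 are the diagonal entries of [A]. *)
    have dbl p : monomial [:: i; i] p = monomial [:: i] p.
      by rewrite /monomial !big_cons big_nil mulr1 (char2_mulxx F2_cases).
    rewrite /pairing; under eq_bigr do rewrite dbl.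
    by move=> ->; apply: eq_bigr => x _; rewrite dbl.
  exact: (mom2 (Ordinal im) (Ordinal jm)).
exists g => //; apply: leq_trans le _.
by rewrite size_cat size_nseq size_map; apply: (leq_add (leq_b1 _) sz).
Qed.

(** The first binomial satisfies the recursion of [word_coversS] exactly, by Pascal's rule. The
    second term absorbs the constant excess at [s = 3] and the trivial bound [2 ^ s] at [m = s],
    where the code has order 0. *)
Lemma word_covers_bin s m : (3 <= s <= m)%N ->
  word_covers m (m - s) ('C(m, s - 2) + 2 ^ s * 'C(m, s - 3)).
Proof.
elim: m s => [|m IH] s; first by case/andP => /leq_trans h /h.
case: s => [|[|[|s]]] // /andP[_ sm].
rewrite !subSS !subn0.
case: s sm => [|s] sm.
  by apply: (word_coversW _ (@word_covers_quadratic m.+1)); rewrite bin1 bin0; lia.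
have [ms|ms] := leqP m s.+3.
  have -> : (m - s.+3 = 0)%N by lia.
  apply: (word_coversW _ (@word_covers0 m.+1)).
  have -> : m = s.+3 by lia.
  apply: leq_trans (leq_addl _ _); apply: leq_pmulr; rewrite bin_gt0; lia.
have rm : (0 < m - s.+3 <= m)%N by rewrite subn_gt0 ms leq_subr.
apply: word_coversW (word_coversS rm (IH s.+3 _) _); last first.
- by rewrite -subnS; apply: (IH s.+4).
- exact: ltnW.
(* After Pascal's rule, only the correction terms are compared:
   [2 * K * a + K * b <= 2 * K * (a + b)]. *)
rewrite !subSS !subn0 !binS [(2 ^ s.+4)%N]expnS; move: (2 ^ s.+3)%N => K.
lia.
Qed.

(** * Matrices over a code: sphere covering and covering row by row *)

Lemma map_nth_enum_ord (T S : Type) (x0 : T) (g : T -> S) (s : seq T) n :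
  size s = n -> [seq g (nth x0 s (val j)) | j <- enum 'I_n] = map g s.
Proof.
move=> <-; rewrite (map_comp (fun i => g (nth x0 s i)) val) val_enum_ord.
by rewrite (map_comp g (nth x0 s)) map_nth_iota0 // take_size.
Qed.

Lemma leq_card_bigcup (I T : finType) (A : I -> {set T}) :
  (#|\bigcup_i A i| <= \sum_i #|A i|)%N.
Proof.
elim/big_rec2: _ => [|i B S _ le]; first by rewrite cards0.
by rewrite (leq_trans (leq_card_setU _ _)) // leq_add2l.
Qed.

Lemma leq_imset2_card (T1 T2 T : finType) (f : T1 -> T2 -> T)
    (A : {set T1}) (B : {set T2}) : (#|f @2: (A, B)| <= #|A| * #|B|)%N.
Proof. by rewrite -cardsX curry_imset2X leq_imset_card. Qed.

Section Matrices.
Variables (F : finFieldType) (n : nat).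
Implicit Types C : pred 'rV[F]_n.

Lemma gen_cov_radius_le C t rho : covers C t rho -> (gen_cov_radius t C <= rho)%N.
Proof.
move=> c; have [le|lt] := leqP rho n; last first.
  by apply: leq_trans (find_size _ _) _; rewrite size_iota.
have [//|lt] := leqP (gen_cov_radius t C) rho.
by have := before_find 0%N lt; rewrite nth_iota ?ltnS // add0n c.
Qed.

(** If any radius covers, so does [n], the largest possible weight; hence [find] succeeds inside the
    list and does not return its default [n.+1]. *)
Lemma covers_gen_cov_radius C t rho :
  covers C t rho -> covers C t (gen_cov_radius t C).
Proof.
move=> c; have hs : has (covers C t) (iota 0 n.+1).
  apply/hasP; exists n; first by rewrite mem_iota ltnS leqnn.
  apply/forallP => v; have /existsP[w /andP[wC _]] := forallP c v.
  by apply/existsP; exists w; rewrite wC (leq_trans (max_card _)) ?card_ord.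
have := nth_find 0%N hs; rewrite nth_iota ?add0n //.
by move: hs; rewrite has_find size_iota.
Qed.

Definition ball t rho := [set A : 'M[F]_(t, n) | tweight A <= rho]%N.

(** A matrix of weight at most [rho.+1] arises from one of weight at most [rho] by overwriting one
    column: [n] positions and [#|F| ^ t] contents for each unit of radius. *)
Lemma card_ball t rho : (0 < n)%N -> (#|ball t rho| <= (n * #|F| ^ t) ^ rho)%N.
Proof.
move=> n_gt0; elim: rho => [|rho IH].
  rewrite expn0 -(cards1 (0 : 'M[F]_(t, n))); apply/subset_leq_card/subsetP => A.
  rewrite !inE leqn0 cards_eq0 => /eqP A0; apply/eqP/matrixP => i j; rewrite mxE.
  apply/eqP; apply: contraFT (in_set0 j) => Aij; rewrite -A0 inE.
  by apply/existsP; exists i.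
pose put (A : 'M[F]_(t, n)) (jc : 'I_n * 'cV[F]_t) :=
  \matrix_(i, j) (if j == jc.1 then jc.2 i 0 else A i j).
have sub : ball t rho.+1 \subset put @2: (ball t rho, [set: 'I_n * 'cV[F]_t]).
  apply/subsetP => A; rewrite inE => wA.
  have [j jP] : exists j, (tweight (put A (j, 0%R)) <= rho)%N.
    (* Clearing a column of the support lowers the weight; if the support is empty, any column will
       do. *)
    have [/eqP S0|/set0Pn[j jS]] :=
      boolP ([set j | [exists i : 'I_t, A i j != 0]] == set0).
      exists (Ordinal n_gt0); apply: leq_trans (leq0n _); rewrite leqn0 cards_eq0.
      rewrite -subset0 -S0; apply/subsetP => j; rewrite !inE => /existsP[i].
      rewrite mxE; case: ifP => _ /=; first by rewrite mxE eqxx.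
      by move=> h; apply/existsP; exists i.
    exists j; rewrite -ltnS (leq_trans _ wA) //; apply: proper_card.
    apply/properP; split; last first.
      exists j => //; rewrite inE negb_exists; apply/forallP => i.
      by rewrite !mxE !eqxx.
    apply/subsetP => k; rewrite !inE => /existsP[i].
    rewrite mxE; case: ifP => _ /=; first by rewrite mxE eqxx.
    by move=> h; apply/existsP; exists i.
  apply/imset2P; exists (put A (j, 0%R)) (j, col j A); rewrite ?inE //.
  by apply/matrixP => i k; rewrite !mxE /=; case: eqP => [->|//].
apply: leq_trans (subset_leq_card sub) _; apply: leq_trans (leq_imset2_card _ _ _) _.
rewrite cardsT card_prod card_ord card_mx muln1 expnS mulnC leq_mul2l.
by rewrite IH orbT.
Qed.

Lemma sphere_covering C t rho : (0 < n)%N -> covers C t rho ->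
  (#|F| ^ (t * n) <= #|[set w | C w]| ^ t * (n * #|F| ^ t) ^ rho)%N.
Proof.
move=> n_gt0 c; rewrite -card_mx -cardsT.
pose D := [set d : {ffun 'I_t -> 'rV[F]_n} | [forall i, C (d i)]].
have cD : #|D| = (#|[set w | C w]| ^ t)%N.
  have := card_ffun_on 'I_t (mem [set w | C w]); rewrite card_ord => <-.
  apply: eq_card => d.
  rewrite inE; apply/forallP/ffun_onP => h i; by have := h i; rewrite inE.
rewrite -cD; apply: leq_trans (leq_mul (leqnn _) (card_ball t rho n_gt0)).
pose mx (d : {ffun 'I_t -> 'rV[F]_n}) (A : 'M[F]_(t, n)) := A + \matrix_i d i.
apply: leq_trans (leq_imset2_card mx _ _).
apply/subset_leq_card/subsetP => v _.
have /existsP[w /andP[/forallP wC wv]] := forallP c v.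
apply/imset2P; exists [ffun i => row i w] (v - w); rewrite ?inE //.
  by apply/forallP => i; rewrite ffunE.
by apply/matrixP => i j; rewrite !mxE ffunE mxE subrK.
Qed.
End Matrices.

(** The codimension is at least the number of monomials of degree [r.+1]. Pascal's rule matches the
    two factors of (u | u+v); repetitions in the list could only enlarge its size. *)
Lemma size_RM_list m r :
  (size (RM_list m r) * 2 ^ 'C(m, r.+1) <= 2 ^ 2 ^ m)%N.
Proof.
elim: m r => [|m IH] r; first by rewrite RM_list_full.
have [mr|rm] := leqP m.+1 r.
  by rewrite RM_list_full // size_all_words bin_small ?ltnS // muln1.
case: r rm => [|r] rm.
  by rewrite /= bin1 -expnS leq_exp2l // ltn_expl.
rewrite RM_listS // size_allpairs binS expnD mulnACA.
by rewrite expnS [(2 * 2 ^ m)%N]mul2n -addnn expnD leq_mul.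
Qed.

Lemma card_RM m r : (#|[set w | RM r m w]| <= size (RM_list m r))%N.
Proof.
pose f (w : 'rV['F_2]_(2 ^ m)) := [seq w ord0 j | j <- enum 'I_(2 ^ m)].
have f_inj : injective f.
  by move=> u v /eq_in_map e; apply/rowP => j; apply: e; rewrite mem_enum.
rewrite cardE -(size_map f); apply: uniq_leq_size.
  by rewrite map_inj_uniq // enum_uniq.
by move=> x /mapP[w + ->]; rewrite mem_enum inE.
Qed.

(** Each row is approximated separately, and the support of the difference matrix is the union of
    the row supports. *)
Lemma covers_RM t m r rho : word_covers m r rho -> covers (RM r m) t (t * rho).
Proof.
move=> wc; apply/forallP => v.
pose w := nth [::] (all_words m).
have szw := size_all_words m.
(* Row [i] becomes a function on points, the coordinate [j] being the [j]-th word of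
   [all_words m]. *)
pose f i x := [seq v i j | j <- enum 'I_(2 ^ m)]`_(index x (all_words m)).
have fE i (j : 'I_(2 ^ m)) : f i (w j) = v i j.
  rewrite /f index_uniq ?szw ?all_words_uniq //.
  by rewrite (nth_map j) ?size_enum_ord // nth_ord_enum.
have wc' i : exists g : {ffun 'I_(2 ^ m) -> 'F_2},
    ([seq g j | j <- enum 'I_(2 ^ m)] \in RM_list m r) &&
    (#|[set j | v i j != g j]| <= rho)%N.
  have [g gR gle] := wc (f i); exists [ffun j => g (w (val j))].
  apply/andP; split.
    by under eq_map => j do rewrite ffunE; rewrite map_nth_enum_ord.
  apply: leq_trans gle.
  have -> : all_words m = [seq w (val j) | j <- enum 'I_(2 ^ m)].
    by rewrite (map_nth_enum_ord [::] id szw) map_id.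
  rewrite count_map cardE -size_filter.
  apply: uniq_leq_size; first exact: enum_uniq.
  by move=> j; rewrite mem_enum mem_filter mem_enum !inE ffunE -fE => ->.
pose c i := xchoose (wc' i).
have cP i := andP (xchooseP (wc' i)).
apply/existsP; exists (\matrix_(i, j) c i j); apply/andP; split.
  apply/forallP => i; rewrite /RM; have [cR _] := cP i.
  by under eq_map => j do rewrite !mxE.
have -> : (t * rho = \sum_(i < t) rho)%N by rewrite sum_nat_const card_ord.
apply: leq_trans (_ : (\sum_i #|[set j | v i j != c i j]| <= _)%N); last first.
  by apply: leq_sum => i _; have [] := cP i.
apply: leq_trans (leq_card_bigcup _).
apply/subset_leq_card/subsetP => j; rewrite inE => /existsP[i vc].
by apply/bigcupP; exists i => //; rewrite inE; move: vc; rewrite !mxE subr_eq0.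
Qed.

(** * Explicit bounds over the natural numbers *)

Local Open Scope nat_scope.

Lemma ffact_le_expn m k : m ^_ k <= m ^ k.
Proof. by elim: k => // k IH; rewrite ffactnSr expnSr leq_mul ?leq_subr. Qed.

(** Each new factor [m - k.+1] loses at most [k.+1] times a power of [m]; the square is a crude
    bound for the sum of these losses. *)
Lemma expn_le_ffact m k : m ^ k.+1 <= m ^_ k.+1 + k.+1 ^ 2 * m ^ k.
Proof.
elim: k => [|k IH]; first by rewrite ffactn1 expn1 leq_addr.
rewrite expnSr ffactnSr; have := ffact_le_expn m k.+1.
move: IH; rewrite [m ^ k.+1]expnSr; move: (m ^_ _) (m ^ k) => a b IH ab.
apply: leq_trans (leq_mul IH (leqnn m)) _.
have : a * m <= a * (m - k.+1) + a * k.+1.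
  by rewrite -mulnDr leq_mul2l addnC -leq_subLR leqnn orbT.
rewrite !expnS !expn0; nia.
Qed.

Lemma R_RM_le t s m : 3 <= s <= m ->
  R_RM t (m - s) m <= t * ('C(m, s - 2) + 2 ^ s * 'C(m, s - 3)).
Proof. by move=> sm; apply/gen_cov_radius_le/covers_RM/word_covers_bin. Qed.

Lemma R_RM_ge t s m : 0 < t -> 3 <= s <= m ->
  t * 'C(m, s.-1) <= (m + t) * R_RM t (m - s) m.
Proof.
move=> t_gt0 /[dup] sm /andP[s3 ssm].
(* The upper bound enters only to show that some radius covers, so that the covering radius itself
   does. *)
have /covers_gen_cov_radius/sphere_covering := covers_RM t (word_covers_bin sm).
rewrite -/(R_RM t (m - s) m) expn_gt0 card_Fp // => /(_ isT) cov.
(* In exponential form, scaled by the number of all matrices, the claim follows from the counting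
   bound times the [t]-th power of the codimension bound. *)
rewrite -(leq_exp2l (m := 2)) // -(leq_pmul2l (m := 2 ^ (t * 2 ^ m))) ?expn_gt0 //.
apply: leq_trans (leq_mul cov (leqnn _)) _.
rewrite -expnD mulnAC -(expnM _ (m + t)) leq_mul2r; apply/orP; right.
rewrite ![t * _]mulnC !expnM -expnMn leq_exp2r //.
have -> : 'C(m, s.-1) = 'C(m, (m - s).+1).
  by rewrite -bin_sub; [congr 'C(_, _); lia | lia].
exact: leq_trans (leq_mul (card_RM m (m - s)) (leqnn _)) (size_RM_list m (m - s)).
Qed.

Lemma expn_pow m k : m ^ k = Nat.pow m k.
Proof. by elim: k => // k IH; rewrite expnS IH. Qed.

Lemma factorial_fact k : k`! = fact k.
Proof. by elim: k => // k IH; rewrite factS IH. Qed.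

Lemma R_RM_upper t k m : (k.+3 <= m)%coq_nat ->
  (fact k.+1 * R_RM t (m - k.+3) m <=
   t * (Nat.pow m k.+1 + Nat.pow 2 k.+3 * fact k.+1 * Nat.pow m k))%coq_nat.
Proof.
move/leP => km; apply/leP; rewrite -!expn_pow -factorial_fact.
apply: leq_trans (leq_mul (leqnn _) (R_RM_le t (s := k.+3) _)) _ => //.
rewrite !subSS !subn0 mulnCA leq_mul2l mulnDr; apply/orP; right.
rewrite leq_add //; first by rewrite mulnC bin_ffact ffact_le_expn.
rewrite -mulnA mulnCA leq_mul2l leq_mul2l.
have : 'C(m, k) <= m ^ k.
  by apply: leq_trans (ffact_le_expn m k); rewrite -bin_ffact leq_pmulr // fact_gt0.
by move=> ->; rewrite !orbT.
Qed.

Lemma R_RM_lower t k m : (0 < t)%coq_nat -> (k.+3 <= m)%coq_nat ->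
  (t * Nat.pow m k.+2 <= fact k.+2 * ((m + t) * R_RM t (m - k.+3) m) +
     t * (Nat.pow k.+2 2 * Nat.pow m k.+1))%coq_nat.
Proof.
move=> /leP t0 /leP km; apply/leP; rewrite -!expn_pow -factorial_fact.
apply: leq_trans (leq_mul (leqnn t) (expn_le_ffact m k.+1)) _.
rewrite mulnDr leq_add2r -bin_ffact mulnA mulnC leq_mul2l.
by rewrite (R_RM_ge (s := k.+3)) ?orbT.
Qed.

End RMCovering.

(** * Asymptotics over the reals *)

Open Scope R_scope.

Theorem theorem15 (t s : nat) (ht : (1 <= t)%nat) (hs : (3 <= s)%nat) :
  exists (C1 C2 : R) (M : nat),
    forall m : nat, (s <= m)%nat -> (M <= m)%nat ->
      INR t / INR (fact (s - 1)) * INR m ^ (s - 2)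
        - C1 * (INR m ^ (s - 3) * ln (INR m))
      <= INR (R_RM t (m - s) m)
      /\
      INR (R_RM t (m - s) m)
      <= INR t / INR (fact (s - 2)) * INR m ^ (s - 2) + C2 * INR m ^ (s - 3).
Proof.
destruct s as [|[|[|k]]]; [lia | lia | lia |].
replace (S (S (S k)) - 1)%nat with (S (S k)) by lia.
replace (S (S (S k)) - 2)%nat with (S k) by lia.
replace (S (S (S k)) - 3)%nat with k by lia.
set (T := INR t).
assert (T0 : 0 < T) by (apply lt_0_INR; lia).
set (q := INR (S (S k)) ^ 2).
(* Dividing the lower bound by [x + T] uses [x * (x - q) >= (x + T) * (x - (T + q))], whence the
   first constant. The second is the correction term of the upper bound, and [m >= 3 >= e] gives
   [ln m >= 1]. *)
exists (T * (T + q) / INR (fact (S (S k)))), (T * 2 ^ S (S (S k))), 3%nat.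
intros m sm m3.
assert (low := RMCovering.R_RM_lower ht sm).
assert (up := RMCovering.R_RM_upper t sm).
apply le_INR in low; apply le_INR in up.
revert low up.
rewrite ?plus_INR, ?mult_INR, ?pow_INR, ?plus_INR, ?mult_INR, ?pow_INR.
change (INR 2) with 2.
change (ssrnat.subn m (S (S (S k)))) with (m - S (S (S k)))%nat.
set (N := INR (R_RM t (m - S (S (S k))) m)).
fold T; fold q; set (x := INR m); intros low up.
assert (x3 : 3 <= x) by (replace 3 with (INR 3) by (simpl; lra); apply le_INR; lia).
assert (P0 : 0 < x ^ k) by (apply pow_lt; lra).
assert (K0 : 0 < INR (fact (S (S k)))) by (apply lt_0_INR, lt_O_fact).
assert (L0 : 0 < INR (fact (S k))) by (apply lt_0_INR, lt_O_fact).
assert (q0 : 0 <= q) by (apply pow2_ge_0).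
assert (ln1 : 1 <= ln x).
{ apply Rnot_lt_le; intro h; apply exp_increasing in h.
  rewrite exp_ln in h by lra; pose proof exp_le_3; lra. }
rewrite <- !tech_pow_Rmult in *.
set (P := x ^ k) in *; set (K := INR (fact (S (S k)))) in *.
set (L := INR (fact (S k))) in *.
split.
(* The error obtained has order [m ^ (s - 3)]; the logarithm only weakens it. *)
- apply Rle_trans with ((T * (x * P) - T * (T + q) * P) / K).
  { apply Rminus_le.
    replace (_ - _) with (- (T * (T + q) / K * P * (ln x - 1))) by (field; lra).
    assert (0 <= T * (T + q) / K * P * (ln x - 1)); [|lra].
    repeat apply Rmult_le_pos; try lra.
    now apply Rlt_le, Rinv_0_lt_compat. }
  apply Rmult_le_reg_r with K; [easy|].
  unfold Rdiv; rewrite Rmult_assoc, Rinv_l, Rmult_1_r by lra.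
  apply Rmult_le_reg_r with (x + T); [lra|].
  (* This is exactly the slack in the division by [x + T]. *)
  assert (0 <= T * (T + q) * P * T) by (repeat apply Rmult_le_pos; lra).
  nra.
- apply Rmult_le_reg_l with L; [easy|].
  replace (L * (_ + _)) with (T * (x * P + 2 * (2 * (2 * 2 ^ k)) * L * P)) by (field; lra).
  exact up.
Qed.
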